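(* Let $f:\mathbb{R}\to[0,\infty)$ be such that $0<u(x,t)<\infty$ for all $x\in\mathbb{R}$, $t>0$, where $$u(x,t)=\int_{\mathbb{R}}\frac{1}{2\sqrt{\pi t}}\,e^{-\frac{(x-\xi)^2}{4t}}f(\xi)\,d\xi,$$ and consider the family of probability densities in $\xi\in\mathbb{R}$ with parameters $\theta^1=x\in\mathbb{R}$, $\theta^2=t>0$, $$p(\xi,x,t)=\frac{e^{-\frac{(x-\xi)^2}{4t}}f(\xi)}{2\sqrt{\pi t}\,u(x,t)}.$$ Then the entries $g_{ij}$ of the Fisher information matrix of this family (the components of the metric tensor $g$) are $$g_{11}=(\ln u)''_{xx}+\frac{1}{2t},$$ $$g_{22}=(\ln u)''_{tt}+\frac{2}{t}(\ln u)'_{t}+\frac{1}{2t^{2}},$$ $$g_{12}=(\ln u)''_{xt}+\frac{1}{t}(\ln u)'_{x}.$$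
   Context: The function $f$ is measurable. Primes with subscripts denote partial derivatives, e.g. $(\ln u)''_{xt}=\partial_x\partial_t\ln u$. For a family of probability densities $p(\xi|\theta)$, $\theta=(\theta^1,\theta^2)$, with $\partial_i=\partial/\partial\theta^i$, the Fisher information matrix is $$g_{ij}(\theta)=\int \partial_i\ln p\cdot\partial_j\ln p\cdot p\,d\xi,$$ the integrand being taken as $0$ where $p=0$ (i.e. where $f(\xi)=0$). *)

(* Defs.v *)
From HB Require Import structures.
From mathcomp Require Import all_boot all_order all_algebra.
From mathcomp Require Import all_classical all_reals all_analysis.

Set Implicit Arguments.
Unset Strict Implicit.
Unset Printing Implicit Defensive.

Import Order.TTheory GRing.Theory Num.Theory.
Import numFieldNormedType.Exports.

Local Open Scope classical_set_scope.
Local Open Scope ring_scope.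

(* R with the sigma-algebra of Lebesgue-measurable sets, i.e. the domain of
   completed_lebesgue_measure (plain R carries the Borel sets). *)
Definition lebesgueTypeR (R : realType) : measurableType _ :=
  caratheodory_type ((@wlength R idfun)^*)%mu.

Section two_parameters.
Context {R : realType}.

(* The parameter (theta^1, theta^2) is passed in curried form, and the
   coordinates 1, 2 are the elements 0, 1 of 'I_2. *)
Definition partial (i : 'I_2) (F : R -> R -> R) (x t : R) : R :=
  if i == 0 then derive1 (fun y => F y t) x else derive1 (fun s => F x s) t.

(* derive1 is total, so the existence of the limit is stated separately. *)
Definition partial_exists (i : 'I_2) (F : R -> R -> R) (x t : R) : Prop :=
  if i == 0 then derivable (fun y => F y t) x 1
  else derivable (fun s => F x s) t 1.

Context d (T : measurableType d) (mu : {measure set T -> \bar R}).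

Definition probability_density (q : T -> R) : Prop :=
  [/\ measurable_fun setT q, (forall xi, 0 <= q xi)
    & (\int[mu]_xi (q xi)%:E = 1)%E].

Variable p : T -> R -> R -> R.

Definition score (i : 'I_2) (xi : T) (x t : R) : R :=
  partial i (fun y s => ln (p xi y s)) x t.

Definition fisher_integrand (i j : 'I_2) (x t : R) (xi : T) : R :=
  if p xi x t == 0 then 0
  else score i xi x t * score j xi x t * p xi x t.

Definition fisher_information (x t : R) : 'M[\bar R]_2 :=
  \matrix_(i < 2, j < 2) (\int[mu]_xi (fisher_integrand i j x t xi)%:E)%E.

(* The derivatives and integrals above are genuine ones, not the default
   values of total operators. *)
Definition fisher_well_defined (x t : R) : Prop :=
  [/\ probability_density (fun xi => p xi x t),
      (forall (i : 'I_2) (xi : T), p xi x t != 0 ->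
         partial_exists i (fun y s => ln (p xi y s)) x t)
    & (forall i j : 'I_2,
         mu.-integrable setT (EFin \o fisher_integrand i j x t))].

End two_parameters.

Section heat_family.
Context {R : realType}.
Variable f : R -> R.

Definition heat_integral (x t : R) : \bar R :=
  (\int[completed_lebesgue_measure]_(xi in [set: lebesgueTypeR R])
     ((2 * Num.sqrt (pi * t))^-1 * expR (- ((x - xi) ^+ 2 / (4 * t))) * f xi)%:E)%E.

Definition heat_solution (x t : R) : R := fine (heat_integral x t).

Definition heat_density (xi : lebesgueTypeR R) (x t : R) : R :=
  expR (- ((x - xi) ^+ 2 / (4 * t))) * f xi
  / (2 * Num.sqrt (pi * t) * heat_solution x t).

End heat_family.

(* Main.v *)
(* Write [M_k(x,t)] for the integral over [xi] of
   [(x - xi)^k exp(-(x - xi)^2 / 4t) f(xi)], so that [u = M_0 / (2 sqrt(pi t))].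
   A power of [x - xi] is dominated by a slightly wider Gaussian, so finiteness
   of [u] for all [t > 0] makes every [M_k] finite and allows differentiation
   under the integral sign:
     [d_x M_k = k M_(k-1) - M_(k+1) / 2t]  and  [d_t M_k = M_(k+2) / 4t^2].
   The scores are [-((x - xi) - M_1/M_0) / 2t] and
   [((x - xi)^2 - M_2/M_0) / 4t^2], so the Fisher matrix is, up to these
   factors, the covariance matrix of [(x - xi, (x - xi)^2)]; both sides of each
   identity are then the same rational function of [t] and the [M_k/M_0]. *)

Require Import Defs.
From HB Require Import structures.
From mathcomp Require Import all_boot all_order all_algebra.
From mathcomp Require Import all_classical all_reals all_analysis.
From mathcomp Require Import measurable_realfun ring lra.

Import Order.TTheory GRing.Theory Num.Theory.
Import numFieldNormedType.Exports.

Local Open Scope classical_set_scope.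
Local Open Scope ring_scope.

(** * Calculus rules carrying existence and value of a derivative together *)

Lemma is_derive_mul {R : realType} (F G : R -> R) (x a b : R) :
  is_derive x 1 F a -> is_derive x 1 G b ->
  is_derive x 1 (fun y => F y * G y) (a * G x + F x * b).
Proof.
move=> dF dG; apply: (is_derive_eq (is_deriveM dF dG)).
by rewrite /GRing.scale/= addrC mulrC.
Qed.

Lemma is_derive1_derive1 {R : realType} (F : R -> R) (x a : R) :
  is_derive x 1 F a -> derive1 F x = a.
Proof. by move=> dF; rewrite derive1E; exact: derive_val. Qed.

Lemma is_derive_ln {R : realType} (F : R -> R) (x a : R) : 0 < F x ->
  is_derive x 1 F a -> is_derive x 1 (fun y => ln (F y)) (a / F x).
Proof.
move=> Fx dF; apply: (is_derive_eq (is_derive1_comp (is_derive1_ln Fx) dF)).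
by rewrite mulrC.
Qed.

Lemma is_derive_div {R : realType} (F G : R -> R) (x a b : R) : G x != 0 ->
  is_derive x 1 F a -> is_derive x 1 G b ->
  is_derive x 1 (fun y => F y / G y) ((a - F x / G x * b) / G x).
Proof.
move=> Gx dF dG.
apply: (is_derive_eq (is_derive_mul _ _ _ _ _ dF (is_deriveV Gx dG))).
by rewrite /GRing.scale/=; field.
Qed.

(** The closed formulas in the time variable hold only for positive times; since these form a
    neighbourhood of [t], the derivative at [t] may be taken on the formula. *)
Lemma is_derive_eq_on_pos {R : realType} (F G : R -> R) (t a : R) : 0 < t ->
  (forall s, 0 < s -> F s = G s) -> is_derive t 1 F a -> is_derive t 1 G a.
Proof.
move=> t0 FG; apply: near_eq_is_derive.
by near=> s; apply: FG; near: s; exact: lt_nbhsr.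
Unshelve. all: by end_near. Qed.

Lemma is_derive_invM {R : realType} (a t : R) : 0 < a -> 0 < t ->
  is_derive t 1 (fun s => (a * s)^-1) (- (a * t ^+ 2)^-1).
Proof.
move=> a0 t0; have at0 : a * t != 0 by rewrite mulf_neq0// gt_eqF.
have d4 : is_derive t 1 (fun s : R => a * s) a.
  by apply: is_derive_eq; rewrite /GRing.scale/=; ring.
apply: (is_derive_eq (is_deriveV at0 d4)).
by rewrite /GRing.scale/=; field; rewrite !lt0r_neq0.
Qed.

(** * Differentiation under the integral sign and auxiliary facts *)

(** Dominated convergence: [G] bounds the difference quotients through the mean value theorem
    because it bounds the derivative on the whole interval, not only at [a]. *)
Lemma is_derive_Rintegral {R : realType} {d : measure_display}
    {Y : measurableType d} (mu : {measure set Y -> \bar R}) (B : set Y)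
    (F dF : R -> Y -> R) (G : Y -> R) (a u v : R) :
  measurable B -> a \in `]u, v[ ->
  (forall x, x \in `]u, v[ -> mu.-integrable B (EFin \o F x)) ->
  (forall x y, x \in `]u, v[ -> is_derive x 1 (F ^~ y) (dF x y)) ->
  mu.-integrable B (EFin \o G) ->
  (forall x y, x \in `]u, v[ -> `|dF x y| <= G y) ->
  is_derive a 1 (fun x => \int[mu]_(y in B) F x y)
    (\int[mu]_(y in B) dF a y).
Proof.
move=> mB auv intF dFE intG dFG.
have d1E x y : x \in `]u, v[ -> partial1of2 F x y = dF x y.
  by move=> xuv; rewrite partial1of2E; have ? := dFE x y xuv; exact: derive_val.
have G0 y : 0 <= G y by exact: le_trans (normr_ge0 _) (dFG a y auv).
have derF x y : `]u, v[%classic x -> B y -> derivable (F ^~ y) x 1.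
  by move=> xuv _; have ? := dFE x y xuv; exact: ex_derive.
have d1G x y : `]u, v[%classic x -> B y -> `|partial1of2 F x y| <= G y.
  by move=> xuv _; rewrite d1E//; exact: dFG.
apply: DeriveDef.
  exact: (derivable_under_integral mB auv intF derF G0 intG d1G).
rewrite -derive1E (differentiation_under_integral mB auv intF derF G0 intG d1G).
by congr Rintegral; apply/funext => y; exact: d1E.
Qed.

Lemma EFin_Rintegral {R : realType} {d : measure_display}
    {Y : measurableType d} (mu : {measure set Y -> \bar R}) (B : set Y)
    (F : Y -> R) : measurable B -> mu.-integrable B (EFin \o F) ->
  (\int[mu]_(y in B) (F y)%:E = (\int[mu]_(y in B) F y)%:E)%E.
Proof.
by move=> mB iF; rewrite /Rintegral fineK//; exact: integrable_fin_num.
Qed.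

Lemma ord2_cases (P : 'I_2 -> Prop) : P 0 -> P 1 -> forall i, P i.
Proof.
move=> P0 P1; case=> [[|[|//]] hi].
  by rewrite (_ : Ordinal hi = 0)//; exact: val_inj.
by rewrite (_ : Ordinal hi = 1)//; exact: val_inj.
Qed.

(** * Moment kernels: measurability and Gaussian domination *)

(** Kernels are Borel while [f] is only Lebesgue measurable; their product is formed in the larger
    sigma-algebra. *)
Lemma measurable_fun_lebesgueTypeR {R : realType} (g : R -> R) :
  measurable_fun setT g -> measurable_fun [set: lebesgueTypeR R] g.
Proof.
move=> mg _ B mB; apply: sub_caratheodory.
exact: (mg measurableT B mB).
Qed.

(* The unnormalised heat kernel times [(x - xi) ^+ k]; the factors [x - xi]
   come out of differentiating the kernel in [x] and [t]. *)
Definition moment_kernel {R : realType} (k : nat) (x t xi : R) : R :=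
  (x - xi) ^+ k * expR (- ((x - xi) ^+ 2 / (4 * t))).

Definition moment {R : realType} (f : R -> R) (k : nat) (x t : R) : R :=
  \int[@completed_lebesgue_measure R]_(xi in [set: lebesgueTypeR R])
    (moment_kernel k x t xi * f xi).

Lemma measurable_moment_kernel {R : realType} (k : nat) (x t : R) :
  measurable_fun [set: lebesgueTypeR R] (moment_kernel k x t).
Proof.
have mX n : measurable_fun setT (fun xi : R => (x - xi) ^+ n).
  by apply: measurable_funX; exact: measurable_funB.
apply: measurable_fun_lebesgueTypeR; apply: measurable_funM => //.
apply: measurableT_comp; first exact: measurable_expR.
by apply: measurableT_comp => //; exact: measurable_funM.
Qed.

(** The case of exponent one is |z| <= 1 + z^2 <= (1 + 1/b)(1 + b z^2) <= (1 + 1/b) exp(b z^2). Its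
    [k]-th power has rate k b, which is at most [a] for b = a/(k+1); the successor avoids a division
    by zero at k = 0. *)
Lemma exprn_le_expR {R : realType} (k : nat) (a : R) : 0 < a ->
  exists2 C, 0 <= C & forall z : R, `|z| ^+ k <= C * expR (a * z ^+ 2).
Proof.
move=> a0; pose b := a / k.+1%:R; have b0 : 0 < b by exact: divr_gt0.
exists ((1 + b^-1) ^+ k); first by rewrite exprn_ge0// addr_ge0// invr_ge0 ltW.
move=> z; have z1 : `|z| <= (1 + b^-1) * expR (b * z ^+ 2).
  have zz : `|z| <= 1 + z ^+ 2.
    by rewrite -(real_normK (num_real z)); have := sqr_ge0 (`|z| - 1); nra.
  apply: (le_trans zz); apply: (@le_trans _ _ ((1 + b^-1) * (1 + b * z ^+ 2))).
    have bz : b^-1 * (b * z ^+ 2) = z ^+ 2 by rewrite mulKf// gt_eqF.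
    have bz0 : 0 <= b * z ^+ 2 by rewrite mulr_ge0 ?sqr_ge0// ltW.
    have w0 : 0 < b^-1 by rewrite invr_gt0.
    lra.
  by rewrite ler_wpM2l ?expR_ge1Dx// addr_ge0// invr_ge0 ltW.
apply: (le_trans (lerXn2r k _ _ z1)); rewrite ?nnegrE ?normr_ge0//.
  by rewrite mulr_ge0 ?expR_ge0// addr_ge0// invr_ge0 ltW.
rewrite exprMn ler_wpM2l ?exprn_ge0 ?addr_ge0// ?invr_ge0 ?(ltW b0)//.
rewrite -expRM_natl ler_expR mulrA.
rewrite ler_wpM2r ?sqr_ge0//.
by rewrite /b mulrCA ger_pMr// ler_pdivrMr// mul1r ler_nat.
Qed.

(* [(x - xi)^2 / 2 <= (y - xi)^2 + 1] trades the moving centre for a wider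
   Gaussian; half of the exponent absorbs the power. *)
Lemma moment_kernel_le {R : realType} (k : nat) (x S : R) : 0 < S ->
  exists2 C, 0 <= C & forall y s xi : R, `|y - x| <= 1 -> 0 < s <= S ->
    `|moment_kernel k y s xi| <= C * moment_kernel 0 x (4 * S) xi.
Proof.
(* For s <= S the Gaussian decays at rate at least [2 * a]. One [a] absorbs the power; recentring
   turns the other into [a / 2], the rate of the Gaussian at time [4 * S], at the cost of the factor
   [expR a]. *)
move=> S0; pose a := (8 * S)^-1; have a0 : 0 < a by rewrite invr_gt0; lra.
have [C C0 hC] := exprn_le_expR k _ a0.
exists (C * expR a); first by rewrite mulr_ge0// expR_ge0.
move=> y s xi yx1 /andP[s0 sS].
rewrite /moment_kernel expr0 mul1r normrM normrX (ger0_norm (expR_ge0 _)).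
have se :
    expR (- ((y - xi) ^+ 2 / (4 * s))) <= expR (- (2 * a * (y - xi) ^+ 2)).
  rewrite ler_expR lerN2 mulrC ler_wpM2l ?sqr_ge0//.
  have -> : 2 * a = (4 * S)^-1 by rewrite /a; field; lra.
  by rewrite lef_pV2 ?posrE; lra.
apply: (le_trans (ler_pM _ _ (hC _) se)); rewrite ?exprn_ge0 ?expR_ge0//.
rewrite -!(mulrA C) ler_wpM2l// -!expRD ler_expR.
have -> : (x - xi) ^+ 2 / (4 * (4 * S)) = a / 2 * (x - xi) ^+ 2.
  by rewrite /a; field; lra.
have : (x - xi) ^+ 2 / 2 <= (y - xi) ^+ 2 + 1.
  have h : (y - x) ^+ 2 <= 1.
    by rewrite -(real_normK (num_real _)) expr_le1.
  (* With A = y - xi and B = y - x this is (A - B)^2 <= 2 A^2 + 2 B^2, equivalent to (A + B)^2 >=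
     0. *)
  by have := sqr_ge0 (y - xi + (y - x)); nra.
by move=> h; have := ler_wpM2l (ltW a0) h; lra.
Qed.

(** * Derivatives of the moment kernels *)

Lemma is_derive_gaussian_exponent_t {R : realType} (a t : R) : 0 < t ->
  is_derive t 1 (fun s => - (a / (4 * s))) (a / (4 * t ^+ 2)).
Proof.
move=> t0; have d4 := is_derive_invM 4 t (ltr0n _ 4) t0.
apply: (is_derive_eq (is_deriveN (is_derive_mul (fun=> a) _ t _ _
  (is_derive_cst _ _ _) d4))).
by rewrite mul0r add0r mulrN opprK.
Qed.

Lemma is_derive_gaussian_exponent_x {R : realType} (xi t x : R) :
  is_derive x 1 (fun y => - ((y - xi) ^+ 2 / (4 * t))) (- ((x - xi) / (2 * t))).
Proof.
have h : is_derive x 1 (fun y : R => y - xi) 1.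
  by apply: is_derive_eq; rewrite subr0.
apply: (is_derive_eq (is_deriveN (is_derive_mul _ (fun=> (4 * t)^-1) x _ _
  (is_derive_mul _ _ _ _ _ h h) (is_derive_cst _ _ _)))).
have -> : (2 * t)^-1 = 2 * (4 * t)^-1.
  by rewrite !invfM mulrA; congr (_ * _); field.
by ring.
Qed.

(** The power loses one degree, the exponential contributes one. At k = 0 the truncated [k.-1] is
    harmless, as its coefficient vanishes. *)
Lemma is_derive_moment_kernel_x {R : realType} (k : nat) (x t xi : R) :
  is_derive x 1 (fun y => moment_kernel k y t xi)
    (k%:R * moment_kernel k.-1 x t xi - (2 * t)^-1 * moment_kernel k.+1 x t xi).
Proof.
have h : is_derive x 1 (fun y : R => y - xi) 1.
  by apply: is_derive_eq; rewrite subr0.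
have hX : is_derive x 1 (fun y : R => (y - xi) ^+ k) (k%:R * (x - xi) ^+ k.-1).
  have := is_deriveX k h; rewrite exprfctE => hk; apply: (is_derive_eq hk).
  by rewrite /GRing.scale/= mulr1.
have hE := is_derive1_comp (is_derive_expR _)
  (is_derive_gaussian_exponent_x xi t x).
apply: (is_derive_eq (is_derive_mul _ _ _ _ _ hX hE)).
by rewrite /moment_kernel /= (exprS _ k); ring.
Qed.

Lemma is_derive_moment_kernel_t {R : realType} (k : nat) (x t xi : R) : 0 < t ->
  is_derive t 1 (fun s => moment_kernel k x s xi)
    ((4 * t ^+ 2)^-1 * moment_kernel k.+2 x t xi).
Proof.
move=> t0.
have hE := is_derive1_comp (is_derive_expR _)
  (is_derive_gaussian_exponent_t ((x - xi) ^+ 2) t t0).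
apply: (is_derive_eq (is_derive_mul (fun=> (x - xi) ^+ k) _ _ _ _
  (is_derive_cst _ _ _) hE)).
by rewrite /moment_kernel /= (exprS _ k.+1) (exprS _ k); ring.
Qed.

Lemma heat_factor_gt0 {R : realType} (t : R) :
  0 < t -> 0 < 2 * Num.sqrt (pi * t).
Proof. by move=> t0; rewrite mulr_gt0// sqrtr_gt0 mulr_gt0// pi_gt0. Qed.

(** The constants that differentiating -(x - xi)^2 / 4t in the coordinate [i] puts in front of (x -
    xi)^(i+1). *)
Definition score_coef {R : realType} (i : 'I_2) (t : R) : R :=
  if i == 0 then - (2 * t)^-1 else (4 * t ^+ 2)^-1.

(** The expectation of (x - xi)^k under the density p. *)
Definition normalized_moment {R : realType} (f : R -> R) (k : nat) (x t : R) :=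
  moment f k x t / moment f 0 x t.

(** * Integrability and derivatives of the moments *)

Section heat_moments.
Context {R : realType} (f : R -> R).
Hypothesis f_ge0 : forall xi, 0 <= f xi.
Hypothesis f_meas : measurable_fun [set: lebesgueTypeR R] f.
Hypothesis u_bnd : forall x t : R, 0 < t -> (0 < heat_integral f x t < +oo)%E.

Let mu := @completed_lebesgue_measure R.

Lemma measurable_moment_integrand (k : nat) (x t : R) :
  measurable_fun [set: lebesgueTypeR R]
    (fun xi => moment_kernel k x t xi * f xi).
Proof. by apply: measurable_funM => //; exact: measurable_moment_kernel. Qed.

(** Up to a positive constant this is the integrand of [u]; since it is nonnegative, finiteness of
    [u] is its integrability. *)
Lemma integrable_moment0 (x t : R) : 0 < t ->
  mu.-integrable setT
    (EFin \o (fun xi : lebesgueTypeR R => moment_kernel 0 x t xi * f xi)).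
Proof.
move=> t0.
have -> : EFin \o (fun xi : lebesgueTypeR R => moment_kernel 0 x t xi * f xi) =
  (fun xi : lebesgueTypeR R => (2 * Num.sqrt (pi * t))%:E *
   ((2 * Num.sqrt (pi * t))^-1 * expR (- ((x - xi) ^+ 2 / (4 * t)))
    * f xi)%:E)%E.
  apply/funext => xi /=; rewrite -EFinM /moment_kernel expr0 mul1r !mulrA.
  by rewrite mulfV ?mul1r// gt_eqF// heat_factor_gt0.
apply: integrableZl => //; apply/integrableP; split.
  apply/measurable_EFinP.
  have := measurable_funM
    (@measurable_cst _ _ _ _ setT (2 * Num.sqrt (pi * t))^-1)
    (measurable_moment_integrand 0 x t).
  congr measurable_fun; apply/funext => xi /=.
  by rewrite /moment_kernel expr0 mul1r mulrA.
have /andP[_] := u_bnd x t t0; congr (_ < _)%E.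
apply: eq_integral => xi _; rewrite gee0_abs// lee_fin.
by rewrite !mulr_ge0 ?expR_ge0// invr_ge0 ltW// heat_factor_gt0.
Qed.

(** Finiteness of [u] at the later time [4 * S] makes the wider Gaussian integrable against [f].
    Uniformity in both centre and time serves the [x]- and the [t]-derivative alike. *)
Lemma moment_integrand_dominated (k : nat) (x S : R) : 0 < S ->
  exists2 G : lebesgueTypeR R -> R, mu.-integrable setT (EFin \o G) &
    forall y s xi : R, `|y - x| <= 1 -> 0 < s <= S ->
      `|moment_kernel k y s xi * f xi| <= G xi.
Proof.
move=> S0; have [C C0 hC] := moment_kernel_le k x S S0.
exists (fun xi => C * (moment_kernel 0 x (4 * S) xi * f xi)).
  have -> : EFin \o (fun xi : lebesgueTypeR R =>
        C * (moment_kernel 0 x (4 * S) xi * f xi)) =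
      (fun xi => C%:E * (moment_kernel 0 x (4 * S) xi * f xi)%:E)%E.
    by apply/funext => xi /=; rewrite EFinM.
  by apply: integrableZl => //; apply: integrable_moment0; lra.
move=> y s xi yx sS; rewrite normrM (ger0_norm (f_ge0 _)) mulrA.
by rewrite ler_wpM2r// hC.
Qed.

Lemma integrable_moment (k : nat) (x t : R) : 0 < t ->
  mu.-integrable setT
    (EFin \o (fun xi : lebesgueTypeR R => moment_kernel k x t xi * f xi)).
Proof.
move=> t0; have [G intG hG] := moment_integrand_dominated k x t t0.
apply: (le_integrable measurableT _ _ intG).
  by apply/measurable_EFinP; exact: measurable_moment_integrand.
move=> xi _; rewrite lee_fin; apply: le_trans (ler_norm _).
by rewrite hG ?subrr ?normr0// t0 lexx.
Qed.

Lemma moment_kernel_comb (k l : nat) (a b x t : R) : 0 < t ->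
  \int[mu]_(xi in [set: lebesgueTypeR R])
    (a * (moment_kernel k x t xi * f xi)
     + b * (moment_kernel l x t xi * f xi)) =
  a * moment f k x t + b * moment f l x t.
Proof.
move=> t0; have iM n := integrable_moment n x t t0.
have iMZ (r : R) n : mu.-integrable setT (EFin \o (fun xi : lebesgueTypeR R =>
    r * (moment_kernel n x t xi * f xi))).
  exact: (integrableZl measurableT r (iM n)).
by rewrite RintegralD// !RintegralZl.
Qed.

Lemma is_derive_moment_x (k : nat) (x t : R) : 0 < t ->
  is_derive x 1 (fun y => moment f k y t)
    (k%:R * moment f k.-1 x t - (2 * t)^-1 * moment f k.+1 x t).
Proof.
move=> t0.
have [G1 iG1 hG1] := moment_integrand_dominated k.-1 x t t0.
have [G2 iG2 hG2] := moment_integrand_dominated k.+1 x t t0.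
pose dF (y : R) (xi : lebesgueTypeR R) :=
  k%:R * (moment_kernel k.-1 y t xi * f xi)
  + - (2 * t)^-1 * (moment_kernel k.+1 y t xi * f xi).
pose G (xi : lebesgueTypeR R) := k%:R * G1 xi + (2 * t)^-1 * G2 xi.
have iG : mu.-integrable setT (EFin \o G).
  exact: (integrableD measurableT (integrableZl measurableT k%:R iG1)
           (integrableZl measurableT (2 * t)^-1 iG2)).
(* Radius one is the range of centres covered by the domination. *)
have xI : x \in `]x - 1, x + 1[ by rewrite in_itv/=; apply/andP; split; lra.
rewrite -mulNr -moment_kernel_comb//.
apply: (is_derive_Rintegral mu setT (fun y xi => moment_kernel k y t xi * f xi)
  dF G x (x - 1) (x + 1) measurableT xI _ _ iG _).
- by move=> y _; exact: integrable_moment.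
- move=> y xi _; apply: (is_derive_eq (is_derive_mul _ (fun=> f xi) y _ _
    (is_derive_moment_kernel_x k y t xi) (is_derive_cst _ _ _))).
  by rewrite /dF; ring.
- move=> y xi; rewrite in_itv/= => /andP[y1 y2].
  have yx : `|y - x| <= 1 by rewrite ler_norml; apply/andP; split; lra.
  have tt : 0 < t <= t by rewrite t0 lexx.
  have t20 : 0 <= (2 * t)^-1 by rewrite invr_ge0; lra.
  apply: (le_trans (ler_normD _ _)); rewrite (normrM k%:R) (normrM (- _)).
  rewrite normrN (ger0_norm t20) normr_nat.
  by apply: lerD; apply: ler_wpM2l => //; [exact: hG1|exact: hG2].
Qed.

Lemma is_derive_moment_t (k : nat) (x t : R) : 0 < t ->
  is_derive t 1 (fun s => moment f k x s) ((4 * t ^+ 2)^-1 * moment f k.+2 x t).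
Proof.
move=> t0; have t20 : 0 < 2 * t by lra.
have [G iG hG] := moment_integrand_dominated k.+2 x (2 * t) t20.
pose dF (s : R) (xi : lebesgueTypeR R) :=
  (4 * s ^+ 2)^-1 * (moment_kernel k.+2 x s xi * f xi).
(* The coefficient 1/(4 s^2) blows up at 0; on the interval from t/2 to 2t it is at most 1/t^2. *)
have iG' := integrableZl measurableT (t ^+ 2)^-1 iG.
have tI : t \in `](t / 2), (2 * t)[ by rewrite in_itv/=; apply/andP; split; lra.
rewrite -RintegralZl//; last exact: integrable_moment.
apply: (is_derive_Rintegral mu setT (fun s xi => moment_kernel k x s xi * f xi)
  dF _ t (t / 2) (2 * t) measurableT tI _ _ iG' _).
- move=> s; rewrite in_itv/= => /andP[s1 s2].
  by apply: integrable_moment => //; lra.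
- move=> s xi; rewrite in_itv/= => /andP[s1 s2].
  have s0 : 0 < s by lra.
  apply: (is_derive_eq (is_derive_mul _ (fun=> f xi) s _ _
    (is_derive_moment_kernel_t k x s xi s0) (is_derive_cst _ _ _))).
  by rewrite /dF; ring.
- move=> s xi; rewrite in_itv/= => /andP[s1 s2].
  have s0 : 0 < s by lra.
  have ss : 0 < s <= 2 * t by rewrite s0 ltW.
  have d0 : 0 < 4 * s ^+ 2 by rewrite mulr_gt0// exprn_gt0.
  rewrite normrM ger0_norm ?invr_ge0 ?(ltW d0)//.
  apply: ler_pM => //; first by rewrite invr_ge0 ltW.
    rewrite lef_pV2 ?posrE ?exprn_gt0//.
    by have : t ^+ 2 <= (2 * s) ^+ 2; [rewrite lerXn2r ?nnegrE//; lra|lra].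
  by apply: hG => //; rewrite subrr normr0.
Qed.

(** * First and second derivatives of ln u through normalized moments *)

Let rho := normalized_moment f.
Let m k x t (xi : lebesgueTypeR R) := moment_kernel k x t xi * f xi.
Let lnu (y s : R) := ln (heat_solution f y s).

Lemma heat_solutionE (x t : R) : 0 < t ->
  heat_solution f x t = (2 * Num.sqrt (pi * t))^-1 * moment f 0 x t.
Proof.
move=> t0; rewrite /moment -RintegralZl//; last exact: integrable_moment.
rewrite /heat_solution /heat_integral /Rintegral; congr fine.
apply: eq_integral => xi _.
by rewrite /moment_kernel expr0 mul1r mulrA.
Qed.

Lemma heat_solution_gt0 (x t : R) : 0 < t -> 0 < heat_solution f x t.
Proof. by move=> t0; apply: fine_gt0; exact: u_bnd. Qed.

Lemma moment0_gt0 (x t : R) : 0 < t -> 0 < moment f 0 x t.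
Proof.
move=> t0; have := heat_solution_gt0 x t t0.
by rewrite heat_solutionE// pmulr_rgt0// invr_gt0 heat_factor_gt0.
Qed.

Lemma heat_densityE (xi x t : R) : 0 < t ->
  heat_density f xi x t = moment_kernel 0 x t xi * f xi / moment f 0 x t.
Proof.
move=> t0; rewrite /heat_density heat_solutionE// mulrA mulfV ?mul1r.
  by rewrite /moment_kernel expr0 mul1r.
by rewrite gt_eqF// heat_factor_gt0.
Qed.

(** The normalising prefactor depends on [t] alone, so [x]-derivatives of ln u are those of ln M_0,
    and [t]-derivatives gain only that of -(ln t)/2. *)
Lemma ln_heat_solution (x t : R) : 0 < t ->
  ln (heat_solution f x t) = ln (moment f 0 x t) - (ln 2 + (ln pi + ln t) / 2).
Proof.
move=> t0; have m0 := moment0_gt0 x t t0; have h0 := heat_factor_gt0 t t0.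
have s0 : 0 < Num.sqrt (pi * t) by rewrite sqrtr_gt0 mulr_gt0// pi_gt0.
have lns : ln (Num.sqrt (pi * t)) = (ln pi + ln t) / 2.
  rewrite -lnM ?posrE ?pi_gt0// -[in RHS](@sqr_sqrtr _ (pi * t)).
    by rewrite lnXn// mulr2n; field.
  by rewrite mulr_ge0 ?pi_ge0// ltW.
rewrite heat_solutionE// lnM ?posrE ?invr_gt0// lnV ?posrE//.
by rewrite lnM ?posrE// lns addrC.
Qed.

(** Quotient rule: beside the derivative of the power itself, the variation of the density yields a
    covariance of (x - xi)^k with x - xi. *)
Lemma is_derive_normalized_moment_x (k : nat) (x t : R) : 0 < t ->
  is_derive x 1 (fun y => rho k y t)
    (k%:R * rho k.-1 x t - (2 * t)^-1 * (rho k.+1 x t - rho k x t * rho 1 x t)).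
Proof.
move=> t0; have m0 : moment f 0 x t != 0 by rewrite gt_eqF// moment0_gt0.
apply: (is_derive_eq (is_derive_div (fun y => moment f k y t)
  (fun y => moment f 0 y t) _ _ _ m0
  (is_derive_moment_x k x t t0) (is_derive_moment_x 0%N x t t0))).
by rewrite /rho /normalized_moment; field; rewrite m0 gt_eqF.
Qed.

Lemma is_derive_normalized_moment_t (k : nat) (x t : R) : 0 < t ->
  is_derive t 1 (fun s => rho k x s)
    ((4 * t ^+ 2)^-1 * (rho k.+2 x t - rho k x t * rho 2 x t)).
Proof.
move=> t0; have m0 : moment f 0 x t != 0 by rewrite gt_eqF// moment0_gt0.
apply: (is_derive_eq (is_derive_div (fun y => moment f k x y)
  (fun y => moment f 0 x y) _ _ _ m0
  (is_derive_moment_t k x t t0) (is_derive_moment_t 0%N x t t0))).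
by rewrite /rho /normalized_moment; field; rewrite m0 gt_eqF.
Qed.

Lemma is_derive_ln_moment0_x (x t : R) : 0 < t ->
  is_derive x 1 (fun y => ln (moment f 0 y t)) (score_coef 0 t * rho 1 x t).
Proof.
move=> t0; have m0 := moment0_gt0 x t t0.
apply: (is_derive_eq (is_derive_ln (fun y => moment f 0 y t) _ _ m0
  (is_derive_moment_x 0%N x t t0))).
by rewrite /rho /normalized_moment /score_coef eqxx /= mul0r sub0r; ring.
Qed.

Lemma is_derive_ln_moment0_t (x t : R) : 0 < t ->
  is_derive t 1 (fun s => ln (moment f 0 x s)) (score_coef 1 t * rho 2 x t).
Proof.
move=> t0; have m0 := moment0_gt0 x t t0.
apply: (is_derive_eq (is_derive_ln (fun s => moment f 0 x s) _ _ m0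
  (is_derive_moment_t 0%N x t t0))).
by rewrite /rho /normalized_moment /score_coef /= mulrA.
Qed.

Lemma is_derive_ln_heat_x (x t : R) : 0 < t ->
  is_derive x 1 (fun y => lnu y t) (score_coef 0 t * rho 1 x t).
Proof.
move=> t0; rewrite /lnu; under eq_fun do rewrite ln_heat_solution//.
apply: (is_derive_eq (is_deriveB (is_derive_ln_moment0_x x t t0)
  (is_derive_cst _ _ _))).
by rewrite subr0.
Qed.

Lemma is_derive_ln_heat_t (x t : R) : 0 < t ->
  is_derive t 1 (fun s => lnu x s) (score_coef 1 t * rho 2 x t - (2 * t)^-1).
Proof.
move=> t0; apply: (is_derive_eq_on_pos (fun s =>
    ln (moment f 0 x s) - (ln 2 + (ln pi + ln s) / 2)) _ _ _ t0).
  by move=> s s0; rewrite /lnu ln_heat_solution.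
have dl := is_derive1_ln t0.
apply: (is_derive_eq (is_deriveB (is_derive_ln_moment0_t x t t0)
  (is_deriveD (is_derive_cst (ln 2) _ _) (is_derive_mul _ (fun=> 2^-1) _ _ _
  (is_deriveD (is_derive_cst (ln pi) _ _) dl) (is_derive_cst _ _ _))))).
by rewrite invfM; ring.
Qed.

Lemma partial0_ln_heat (x t : R) : 0 < t ->
  partial 0 lnu x t = score_coef 0 t * rho 1 x t.
Proof. by move=> t0; exact/is_derive1_derive1/is_derive_ln_heat_x. Qed.

Lemma partial1_ln_heat (x t : R) : 0 < t ->
  partial 1 lnu x t = score_coef 1 t * rho 2 x t - (2 * t)^-1.
Proof. by move=> t0; exact/is_derive1_derive1/is_derive_ln_heat_t. Qed.

Lemma is_derive_partial0_ln_heat_x (x t : R) : 0 < t ->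
  is_derive x 1 (fun y => partial 0 lnu y t)
    ((4 * t ^+ 2)^-1 * (rho 2 x t - rho 1 x t ^+ 2) - (2 * t)^-1).
Proof.
move=> t0; under eq_fun do rewrite partial0_ln_heat//.
apply: (is_derive_eq (is_derive_mul (fun=> score_coef 0 t) _ _ _ _
  (is_derive_cst _ _ _) (is_derive_normalized_moment_x 1 x t t0))).
(* Lowering the index of [rho 1] produces [rho 0], the source of the term -1/(2t). *)
have r0 : rho 0 x t = 1.
  by rewrite /rho /normalized_moment mulfV// gt_eqF// moment0_gt0.
by rewrite /score_coef eqxx /= r0; field; exact: lt0r_neq0.
Qed.

Lemma is_derive_partial1_ln_heat_x (x t : R) : 0 < t ->
  is_derive x 1 (fun y => partial 1 lnu y t)
    ((4 * t ^+ 2)^-1 * (2 * rho 1 x t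
       - (2 * t)^-1 * (rho 3 x t - rho 2 x t * rho 1 x t))).
Proof.
move=> t0; under eq_fun do rewrite partial1_ln_heat//.
apply: (is_derive_eq (is_deriveB (is_derive_mul (fun=> score_coef 1 t) _ _ _ _
  (is_derive_cst _ _ _) (is_derive_normalized_moment_x 2 x t t0))
  (is_derive_cst _ _ _))).
by rewrite /score_coef /=; ring.
Qed.

(** Gives existence of the mixed derivative in this order; its value agrees with that of the other
    order. *)
Lemma is_derive_partial0_ln_heat_t (x t : R) : 0 < t ->
  is_derive t 1 (fun s => partial 0 lnu x s)
    ((2 * t ^+ 2)^-1 * rho 1 x t
     - (8 * t ^+ 3)^-1 * (rho 3 x t - rho 1 x t * rho 2 x t)).
Proof.
move=> t0; apply: (is_derive_eq_on_pos
    (fun s => - (2 * s)^-1 * rho 1 x s) _ _ _ t0).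
  by move=> s s0; rewrite partial0_ln_heat.
have d2 := is_derive_invM 2 t (ltr0n _ 2) t0.
apply: (is_derive_eq (is_derive_mul _ _ _ _ _ (is_deriveN d2)
  (is_derive_normalized_moment_t 1 x t t0))).
by rewrite fctE; field; exact: lt0r_neq0.
Qed.

Lemma is_derive_partial1_ln_heat_t (x t : R) : 0 < t ->
  is_derive t 1 (fun s => partial 1 lnu x s)
    ((2 * t ^+ 2)^-1 - (2 * t ^+ 3)^-1 * rho 2 x t
     + (16 * t ^+ 4)^-1 * (rho 4 x t - rho 2 x t ^+ 2)).
Proof.
(* The coefficient 1/(4 s^2) is split into inverses of linear functions, so that [is_derive_invM]
   differentiates each factor. *)
move=> t0; apply: (is_derive_eq_on_pos (fun s =>
    (4 * s)^-1 * (1 * s)^-1 * rho 2 x s - (2 * s)^-1) _ _ _ t0).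
  move=> s s0; rewrite partial1_ln_heat// /score_coef/=.
  by rewrite mul1r -invfM -mulrA -expr2.
have d1 := is_derive_invM 1 t ltr01 t0.
have d2 := is_derive_invM 2 t (ltr0n _ 2) t0.
have d4 := is_derive_invM 4 t (ltr0n _ 4) t0.
apply: (is_derive_eq (is_deriveB (is_derive_mul _ _ _ _ _
  (is_derive_mul _ _ _ _ _ d4 d1)
  (is_derive_normalized_moment_t 2 x t t0)) d2)).
by field; exact: lt0r_neq0.
Qed.

(** * Scores and the Fisher matrix as a covariance matrix *)

Lemma heat_density_neq0_gt0 (xi x t : R) : 0 < t ->
  heat_density f xi x t != 0 -> 0 < f xi.
Proof.
move=> t0; rewrite heat_densityE// => h; rewrite lt0r f_ge0 andbT.
by apply: contraNneq h => ->; rewrite mulr0 mul0r.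
Qed.

Lemma ln_heat_density (xi x t : R) : 0 < t -> 0 < f xi ->
  ln (heat_density f xi x t) =
  - ((x - xi) ^+ 2 / (4 * t)) + ln (f xi) - ln (moment f 0 x t).
Proof.
move=> t0 fxi; have m0 := moment0_gt0 x t t0.
rewrite heat_densityE// /moment_kernel expr0 mul1r.
by rewrite ln_div ?posrE ?mulr_gt0 ?expR_gt0// lnM ?posrE ?expR_gt0// expRK.
Qed.

Lemma is_derive_ln_heat_density_x (xi x t : R) : 0 < t -> 0 < f xi ->
  is_derive x 1 (fun y => ln (heat_density f xi y t))
    (score_coef 0 t * (x - xi - rho 1 x t)).
Proof.
move=> t0 fxi; under eq_fun do rewrite ln_heat_density//.
apply: (is_derive_eq (is_deriveB
  (is_deriveD (is_derive_gaussian_exponent_x xi t x)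
  (is_derive_cst _ _ _)) (is_derive_ln_moment0_x x t t0))).
by rewrite /score_coef eqxx; ring.
Qed.

Lemma is_derive_ln_heat_density_t (xi x t : R) : 0 < t -> 0 < f xi ->
  is_derive t 1 (fun s => ln (heat_density f xi x s))
    (score_coef 1 t * ((x - xi) ^+ 2 - rho 2 x t)).
Proof.
move=> t0 fxi; apply: (is_derive_eq_on_pos (fun s =>
    - ((x - xi) ^+ 2 / (4 * s)) + ln (f xi) - ln (moment f 0 x s)) _ _ _ t0).
  by move=> s s0; rewrite ln_heat_density.
apply: (is_derive_eq (is_deriveB (is_deriveD
  (is_derive_gaussian_exponent_t ((x - xi) ^+ 2) t t0)
  (is_derive_cst _ _ _)) (is_derive_ln_moment0_t x t t0))).
by rewrite /score_coef /=; ring.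
Qed.

Lemma score_heat_density (i : 'I_2) (xi x t : R) : 0 < t -> 0 < f xi ->
  score (heat_density f) i xi x t =
  score_coef i t * ((x - xi) ^+ i.+1 - rho i.+1 x t).
Proof.
move=> t0 fxi; elim/ord2_cases: i; apply: is_derive1_derive1.
  by rewrite expr1; exact: is_derive_ln_heat_density_x.
exact: is_derive_ln_heat_density_t.
Qed.

(** Where [f] vanishes, the conventional value 0 agrees with the right side, every term of which
    contains [f]; elsewhere the product of the two centred powers is expanded. The pairing of terms
    matches [moment_kernel_comb]. *)
Lemma fisher_integrand_heat (i j : 'I_2) (x t : R) (xi : lebesgueTypeR R) :
  0 < t ->
  fisher_integrand (heat_density f) i j x t xi =
  score_coef i t * score_coef j t / moment f 0 x t *
  ((1 * m (i.+1 + j.+1) x t xi + - rho j.+1 x t * m i.+1 x t xi) +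
   (- rho i.+1 x t * m j.+1 x t xi + rho i.+1 x t * rho j.+1 x t * m 0 x t xi)).
Proof.
move=> t0; rewrite /fisher_integrand.
have [fxi|fxi] := eqVneq (f xi) 0.
  by rewrite heat_densityE// /m fxi !(mulr0, mul0r, addr0) eqxx.
have fxi0 : 0 < f xi by rewrite lt0r fxi f_ge0.
rewrite ifN; last first.
  rewrite heat_densityE// /moment_kernel expr0 mul1r.
  by rewrite gt_eqF// divr_gt0 ?mulr_gt0 ?expR_gt0// moment0_gt0.
rewrite !score_heat_density// heat_densityE//.
by rewrite /m /moment_kernel exprD expr0; ring.
Qed.

Lemma integrable_moment_comb (k l : nat) (a b x t : R) : 0 < t ->
  mu.-integrable setT (EFin \o (fun xi => a * m k x t xi + b * m l x t xi)).
Proof.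
move=> t0; exact: (integrableD measurableT
  (integrableZl measurableT a (integrable_moment k x t t0))
  (integrableZl measurableT b (integrable_moment l x t t0))).
Qed.

Lemma integrable_fisher_heat (i j : 'I_2) (x t : R) : 0 < t ->
  mu.-integrable setT (EFin \o fisher_integrand (heat_density f) i j x t).
Proof.
move=> t0.
rewrite (funext (fun xi => fisher_integrand_heat i j x t xi t0)).
exact: (integrableZl measurableT _ (integrableD measurableT
  (integrable_moment_comb _ _ _ _ x t t0)
  (integrable_moment_comb _ _ _ _ x t t0))).
Qed.

(** After integration the two cross terms and the constant term combine to a single negative product
    of means. *)
Lemma fisher_information_heat (i j : 'I_2) (x t : R) : 0 < t ->
  fisher_information mu (heat_density f) x t i j =
  (score_coef i t * score_coef j t *
   (rho (i.+1 + j.+1) x t - rho i.+1 x t * rho j.+1 x t))%:E.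
Proof.
move=> t0; have m0 : moment f 0 x t != 0 by rewrite gt_eqF// moment0_gt0.
rewrite mxE EFin_Rintegral//; last exact: integrable_fisher_heat.
congr EFin; under eq_Rintegral do rewrite fisher_integrand_heat//.
rewrite RintegralZl//; last exact: (integrableD measurableT
  (integrable_moment_comb _ _ _ _ x t t0)
  (integrable_moment_comb _ _ _ _ x t t0)).
rewrite RintegralD//; [|exact: integrable_moment_comb..].
rewrite !moment_kernel_comb// /rho /normalized_moment.
by field.
Qed.

(** * The density property and existence of all derivatives and integrals *)

Lemma probability_density_heat (x t : R) : 0 < t ->
  probability_density mu (fun xi => heat_density f xi x t).
Proof.
move=> t0; have m0 := moment0_gt0 x t t0.
have -> : (fun xi => heat_density f xi x t) =
    (fun xi => (moment f 0 x t)^-1 * m 0 x t xi).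
  by apply/funext => xi; rewrite heat_densityE// mulrC.
split.
- by apply: measurable_funM => //; exact: measurable_moment_integrand.
- move=> xi; rewrite mulr_ge0 ?invr_ge0 ?(ltW m0)//.
  by rewrite /m /moment_kernel expr0 mul1r mulr_ge0 ?expR_ge0.
- rewrite EFin_Rintegral//; last first.
    exact: (integrableZl measurableT _ (integrable_moment 0 x t t0)).
  by rewrite RintegralZl ?mulVf ?gt_eqF//; exact: integrable_moment.
Qed.

Lemma fisher_well_defined_heat (x t : R) : 0 < t ->
  fisher_well_defined mu (heat_density f) x t.
Proof.
move=> t0; split; first exact: probability_density_heat.
  move=> i xi /(heat_density_neq0_gt0 _ _ _ t0) fxi; elim/ord2_cases: i.
    have ? := is_derive_ln_heat_density_x xi x t t0 fxi; exact: ex_derive.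
  have ? := is_derive_ln_heat_density_t xi x t t0 fxi; exact: ex_derive.
by move=> i j; exact: integrable_fisher_heat.
Qed.

Lemma partial_exists_ln_heat (i : 'I_2) (x t : R) : 0 < t ->
  partial_exists i lnu x t.
Proof.
move=> t0; elim/ord2_cases: i.
  have ? := is_derive_ln_heat_x x t t0; exact: ex_derive.
have ? := is_derive_ln_heat_t x t t0; exact: ex_derive.
Qed.

Lemma partial2_exists_ln_heat (i j : 'I_2) (x t : R) : 0 < t ->
  partial_exists i (partial j lnu) x t.
Proof.
move=> t0; elim/ord2_cases: i; elim/ord2_cases: j.
- have ? := is_derive_partial0_ln_heat_x x t t0; exact: ex_derive.
- have ? := is_derive_partial1_ln_heat_x x t t0; exact: ex_derive.
- have ? := is_derive_partial0_ln_heat_t x t t0; exact: ex_derive.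
- have ? := is_derive_partial1_ln_heat_t x t t0; exact: ex_derive.
Qed.

End heat_moments.

Theorem theorem1 (R : realType) (f : R -> R)
    (f_ge0 : forall xi : R, 0 <= f xi)
    (f_meas : measurable_fun [set: lebesgueTypeR R] f)
    (u_bnd : forall x t : R, 0 < t -> (0 < heat_integral f x t < +oo)%E)
    (x t : R) (t_gt0 : 0 < t) :
  let lnu := fun y s : R => ln (heat_solution f y s) in
  let g := fisher_information (@completed_lebesgue_measure R)
             (heat_density f) x t in
  [/\ fisher_well_defined (@completed_lebesgue_measure R)
        (heat_density f) x t,
      (forall i : 'I_2, partial_exists i lnu x t)
      /\ (forall i j : 'I_2, partial_exists i (partial j lnu) x t),
      g 0 0 = (partial 0 (partial 0 lnu) x t + 1 / (2 * t))%:E,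
      g 1 1 = (partial 1 (partial 1 lnu) x t
               + 2 / t * partial 1 lnu x t + 1 / (2 * t ^+ 2))%:E
    & g 0 1 = (partial 0 (partial 1 lnu) x t
               + 1 / t * partial 0 lnu x t)%:E].
Proof.
move=> lnu g; have tn0 : t != 0 by rewrite gt_eqF.
have p00 : partial 0 (partial 0 lnu) x t = _ := is_derive1_derive1 _ _ _
  (is_derive_partial0_ln_heat_x f f_ge0 f_meas u_bnd x t t_gt0).
have p11 : partial 1 (partial 1 lnu) x t = _ := is_derive1_derive1 _ _ _
  (is_derive_partial1_ln_heat_t f f_ge0 f_meas u_bnd x t t_gt0).
have p01 : partial 0 (partial 1 lnu) x t = _ := is_derive1_derive1 _ _ _
  (is_derive_partial1_ln_heat_x f f_ge0 f_meas u_bnd x t t_gt0).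
have p0 := partial0_ln_heat f f_ge0 f_meas u_bnd x t t_gt0.
have p1 := partial1_ln_heat f f_ge0 f_meas u_bnd x t t_gt0.
have gE i j := fisher_information_heat f f_ge0 f_meas u_bnd i j x t t_gt0.
split; first exact: fisher_well_defined_heat.
- split=> [i|i j]; first exact: partial_exists_ln_heat.
  exact: partial2_exists_ln_heat.
(* In each identity the added terms cancel everything in the second derivative of ln u except the
   covariance; for the entry 22 the constants are 1/(2t^2) - 1/t^2 + 1/(2t^2) = 0. *)
- by rewrite /g gE p00 /score_coef /=; congr EFin; field.
- by rewrite /g gE p11 p1 /score_coef /=; congr EFin; field.
- by rewrite /g gE p01 p0 /score_coef /=; congr EFin; field.
Qed.
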